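(* Fix $t_0<0$ and $\alpha>0$. For $\epsilon\in(0,1)$ and $\Delta t>0$ let $t_m=t_0+m\Delta t$ for $m\in\mathbb{N}\cup\{0\}$, and let $\{x(m)\}$ be the solution of $$x(m+1)=-\frac{\Delta t}{\epsilon}x(m)^2+x(m)-\frac{\Delta t}{\epsilon}t_m\quad (m\in\mathbb{N}\cup\{0\}),\qquad x(0)=\sqrt{-t_0}+\alpha\epsilon .$$ (a) (Tipping at $m=1$) Let $\Delta t>1/\alpha$. Then $x(1)<-\sqrt{\max\{-t_1,0\}}$, that is, $x(1)$ is the tipping point. (b) (Tipping at $m=3$) Let $\Delta t=C\epsilon^b$ with $C>0$ and $b\in(0,1/2)$ (constants independent of $\epsilon$), and suppose that $\alpha>1/(-4t_0)$. Then there exists a small $\epsilon_0>0$ such that for every $\epsilon\in(0,\epsilon_0)$ the solution $\{x(m)\}$ satisfies: (i) $x(m)>0$ and $(-1)^m\big(x(m)-\sqrt{-t_m}\big)>0$ for $m=1,2$; and (ii) $x(3)<-\sqrt{-t_3}$.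
   Context: $\mathbb{N}=\{1,2,\dots\}$. Let $m_{\rm tip}:=\inf\{m\in\mathbb{N}: x(m)<-\sqrt{\max\{-t_m,0\}}\}$. The time $t_{m_{\rm tip}}$ is called the tipping time and the value $x(m_{\rm tip})$ the tipping point of the solution $\{x(m)\}$. *)

(* Defs.v *)
From Stdlib Require Import Reals.
From Coquelicot Require Import Coquelicot.
Open Scope R_scope.

Definition tm (t0 dt : R) (m : nat) : R := t0 + INR m * dt.

Fixpoint xsol (t0 alpha eps dt : R) (m : nat) : R :=
  match m with
  | O => sqrt (- t0) + alpha * eps
  | S k =>
      let y := xsol t0 alpha eps dt k in
      - (dt / eps) * y ^ 2 + y - dt / eps * tm t0 dt k
  end.

(* [m_tip], an infimum over m >= 1 with values in the extended reals:
   [p_infty] when the solution never tips. *)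
Definition mtip (t0 alpha eps dt : R) : Rbar :=
  Glb_Rbar (fun r => exists m : nat,
    (1 <= m)%nat /\ r = INR m /\
    xsol t0 alpha eps dt m < - sqrt (Rmax (- tm t0 dt m) 0)).

(* The term x(m) of the solution is its tipping point x(m_tip).  The index is
   compared, not the value, since a value may occur at several indices. *)
Definition tipping_point_at (t0 alpha eps dt : R) (m : nat) : Prop :=
  mtip t0 alpha eps dt = Finite (INR m).

(* Main.v *)
(** Write [s = sqrt (- t0)] and [r = sqrt (- t_m)].  One step gives
    [x(m+1) + r = (x(m) + r) (1 - (dt / eps) (x(m) - r))], so a positive [x(m)]
    that exceeds [r] by more than [eps / dt] is thrown below [- r] at once.  For
    [m = 0] the excess is [alpha eps], which gives (a).

    For (b), put [h = dt] and [q = eps / dt^2]; both tend to [0] because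
    [b < 1/2].  In these variables [x(1)], [(- t_1 - x(1)^2) / h] and
    [q (x(2) - s - eps / dt)] are polynomials in [h] and [q], and at
    [h = q = 0] they take the values [s], [4 s^2 alpha - 1] and
    [4 s^2 alpha - 1].  All three are positive when [alpha > 1 / (4 s^2)]. *)

Require Import Defs.
From Stdlib Require Import Reals Lra Lia.
From Coquelicot Require Import Coquelicot.
Open Scope R_scope.

Lemma sqrt_Rmax_0 (x : R) : sqrt (Rmax x 0) = sqrt x.
Proof.
  destruct (Rle_dec x 0) as [hx | hx].
  - now rewrite Rmax_right, sqrt_0, sqrt_neg_0.
  - now rewrite Rmax_left by lra.
Qed.

Lemma continuity_2d_pt_pos (f : R -> R -> R) (x y : R) :
  continuity_2d_pt f x y -> 0 < f x y -> locally_2d (fun u v => 0 < f u v) x y.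
Proof.
  intros hf hpos.
  apply locally_2d_impl with (2 := hf (mkposreal _ hpos)).
  apply locally_2d_forall; simpl; intros u v huv%Rabs_def2; lra.
Qed.

Lemma filterlim_locally_2d {T : Type} (F : (T -> Prop) -> Prop) {FF : Filter F}
    (f g : T -> R) (x y : R) (P : R -> R -> Prop) :
  filterlim f F (locally x) -> filterlim g F (locally y) ->
  locally_2d P x y -> F (fun t => P (f t) (g t)).
Proof.
  intros hf hg [d hP].
  assert (hfd := proj1 (filterlim_locally f x) hf d).
  assert (hgd := proj1 (filterlim_locally g y) hg d).
  generalize (filter_and _ _ hfd hgd); apply filter_imp.
  intros t [? ?]; now apply hP.
Qed.

Lemma at_right_exists_lt (x M : R) (P : R -> Prop) :
  x < M -> at_right x P ->
  exists y, x < y < M /\ forall z, x < z < y -> P z.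
Proof.
  intros hM [d hP].
  assert (hd := cond_pos d).
  exists (Rmin (x + d) ((x + M) / 2)).
  assert (hl := Rmin_l (x + d) ((x + M) / 2)).
  assert (hr := Rmin_r (x + d) ((x + M) / 2)).
  split; [split; [apply Rmin_glb_lt |]; lra |].
  intros z hz; apply hP; [| lra].
  apply Rabs_def1; unfold minus, plus, opp; simpl; lra.
Qed.

Lemma filterlim_Rpower_at_right_0 (p : R) :
  0 < p -> filterlim (fun e => Rpower e p) (at_right 0) (locally 0).
Proof.
  intros hp.
  apply filterlim_comp with (G := Rbar_locally m_infty) (2 := is_lim_exp_m).
  apply filterlim_comp with (1 := is_lim_ln_0).
  replace m_infty with (Rbar_mult p m_infty) at 2.
  - apply filterlim_Rbar_mult_l.
  - apply is_Rbar_mult_unique, is_Rbar_mult_sym, is_Rbar_mult_m_infty_pos, hp.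
Qed.

Lemma filterlim_scal_Rpower_at_right_0 (c p : R) :
  0 < p -> filterlim (fun e => c * Rpower e p) (at_right 0) (locally 0).
Proof.
  intros hp.
  replace 0 with (c * 0) at 2 by ring.
  apply filterlim_comp with (1 := filterlim_Rpower_at_right_0 p hp).
  apply (filterlim_scal_r c 0).
Qed.

Lemma Rpower_mul_sqr_scal (C b e : R) :
  C <> 0 -> 0 < e ->
  / C ^ 2 * Rpower e (1 - 2 * b) * (C * Rpower e b) ^ 2 = e.
Proof.
  intros hC he.
  transitivity (Rpower e (1 - 2 * b) * (Rpower e b * Rpower e b)).
  - field; exact hC.
  - rewrite <- !Rpower_plus.
    replace (1 - 2 * b + (b + b)) with 1 by ring.
    now apply Rpower_1.
Qed.

Lemma sqrt_opp_tm_antitone (t0 dt : R) (m n : nat) :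
  0 <= dt -> (m <= n)%nat -> sqrt (- tm t0 dt n) <= sqrt (- tm t0 dt m).
Proof.
  intros hdt hmn%le_INR.
  apply sqrt_le_1_alt; unfold tm; nra.
Qed.

Lemma sqrt_opp_tm_le (t0 dt : R) (m : nat) :
  0 <= dt -> sqrt (- tm t0 dt m) <= sqrt (- t0).
Proof.
  intros hdt.
  replace (- t0) with (- tm t0 dt 0) by (unfold tm; simpl; ring).
  apply sqrt_opp_tm_antitone; [exact hdt | lia].
Qed.

Lemma xsol_S_add_sqrt (t0 alpha eps dt : R) (m : nat) :
  tm t0 dt m <= 0 ->
  let x := xsol t0 alpha eps dt in
  let r := sqrt (- tm t0 dt m) in
  x (S m) + r = (x m + r) * (1 - dt / eps * (x m - r)).
Proof.
  intros ht x r.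
  assert (hr : r * r = - tm t0 dt m) by (apply sqrt_sqrt; lra).
  change (x (S m)) with (- (dt / eps) * x m ^ 2 + x m - dt / eps * tm t0 dt m).
  replace (tm t0 dt m) with (- (r * r)) by lra; ring.
Qed.

Lemma xsol_S_lt_of_excess (t0 alpha eps dt : R) (m : nat) :
  0 < eps -> 0 <= dt -> tm t0 dt m <= 0 -> 0 < xsol t0 alpha eps dt m ->
  eps < dt * (xsol t0 alpha eps dt m - sqrt (- tm t0 dt m)) ->
  xsol t0 alpha eps dt (S m) < - sqrt (- tm t0 dt (S m)).
Proof.
  intros he hdt ht hx hexcess.
  assert (hfactor := xsol_S_add_sqrt t0 alpha eps dt m ht); cbv zeta in hfactor.
  assert (hroot := sqrt_opp_tm_antitone t0 dt m (S m) hdt ltac:(lia)).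
  assert (hr := sqrt_pos (- tm t0 dt m)).
  set (x := xsol t0 alpha eps dt m) in *.
  set (r := sqrt (- tm t0 dt m)) in *.
  assert (1 < dt / eps * (x - r)).
  { replace (dt / eps * (x - r)) with (dt * (x - r) / eps) by (field; lra).
    apply Rlt_div_r; lra. }
  nra.
Qed.

Lemma xsol_1_lt (t0 alpha eps dt : R) :
  t0 <= 0 -> 0 < alpha -> 0 < eps -> dt > 1 / alpha ->
  xsol t0 alpha eps dt 1 < - sqrt (- tm t0 dt 1).
Proof.
  intros ht0 ha he hdt.
  assert (hadt : 1 < dt * alpha) by (apply Rlt_div_l; lra).
  assert (hae : 0 < alpha * eps) by nra.
  assert (hs := sqrt_pos (- t0)).
  assert (t0_eq : tm t0 dt 0 = t0) by (unfold tm; simpl; ring).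
  apply xsol_S_lt_of_excess; rewrite ?t0_eq; simpl; nra.
Qed.

Lemma tipping_point_at_of_first (t0 alpha eps dt : R) (m : nat) :
  (1 <= m)%nat ->
  xsol t0 alpha eps dt m < - sqrt (- tm t0 dt m) ->
  (forall k, (1 <= k < m)%nat ->
     - sqrt (- tm t0 dt k) <= xsol t0 alpha eps dt k) ->
  tipping_point_at t0 alpha eps dt m.
Proof.
  intros hm htip hbefore.
  apply is_glb_Rbar_unique; split.
  - intros r (k & hk & -> & hx); rewrite sqrt_Rmax_0 in hx.
    apply le_INR.
    destruct (Nat.le_gt_cases m k) as [| hlt]; [assumption |].
    specialize (hbefore k ltac:(lia)); lra.
  - intros l hl; apply hl; exists m; rewrite sqrt_Rmax_0; auto.
Qed.

Definition tips_at_third_step (t0 alpha eps dt : R) : Prop :=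
  (forall m : nat, m = 1%nat \/ m = 2%nat ->
     xsol t0 alpha eps dt m > 0 /\
     (-1) ^ m * (xsol t0 alpha eps dt m - sqrt (- tm t0 dt m)) > 0) /\
  (tm t0 dt 3 <= 0 /\ xsol t0 alpha eps dt 3 < - sqrt (- tm t0 dt 3)) /\
  tipping_point_at t0 alpha eps dt 3.

Lemma tips_at_third_step_of_excess (t0 alpha eps dt : R) :
  0 < eps -> 0 < dt -> tm t0 dt 3 <= 0 ->
  0 < xsol t0 alpha eps dt 1 ->
  xsol t0 alpha eps dt 1 ^ 2 < - tm t0 dt 1 ->
  eps < dt * (xsol t0 alpha eps dt 2 - sqrt (- t0)) ->
  tips_at_third_step t0 alpha eps dt.
Proof.
  intros he hdt ht3 hx1 hx1sq hexcess.
  assert (hx1r : xsol t0 alpha eps dt 1 < sqrt (- tm t0 dt 1)).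
  { rewrite <- (sqrt_pow2 (xsol t0 alpha eps dt 1)) by lra.
    apply sqrt_lt_1_alt; split; [apply pow2_ge_0 | exact hx1sq]. }
  assert (hs := sqrt_pos (- t0)).
  assert (hr2 := sqrt_opp_tm_le t0 dt 2 ltac:(lra)).
  assert (hx2s : sqrt (- t0) < xsol t0 alpha eps dt 2) by nra.
  assert (hx3 : xsol t0 alpha eps dt 3 < - sqrt (- tm t0 dt 3)).
  { apply xsol_S_lt_of_excess; try lra; [| nra].
    unfold tm in *; simpl in *; lra. }
  split; [| split; [now split |]].
  - intros m [-> | ->]; split; lra.
  - apply tipping_point_at_of_first; [lia | exact hx3 |].
    intros k hk; assert (hr := sqrt_pos (- tm t0 dt k)).
    assert (k = 1%nat \/ k = 2%nat) as [-> | ->] by lia; lra.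
Qed.

(* [(s - x(1)) / h], [x(1)] and [(- t_1 - x(1)^2) / h] for [dt = h] and
   [eps = q h^2]. *)
Definition first_drop_rate (s alpha h q : R) : R :=
  alpha * (2 * s + alpha * (q * h ^ 2) - q * h).

Definition first_iterate (s alpha h q : R) : R :=
  s - h * first_drop_rate s alpha h q.

Definition first_deficit_rate (s alpha h q : R) : R :=
  2 * s * first_drop_rate s alpha h q - h * first_drop_rate s alpha h q ^ 2 - 1.

Lemma xsol_1_scaled (t0 alpha h q : R) :
  t0 <= 0 -> h <> 0 -> q <> 0 ->
  xsol t0 alpha (q * h ^ 2) h 1 = first_iterate (sqrt (- t0)) alpha h q.
Proof.
  intros ht0 hh hq.
  assert (hs : sqrt (- t0) * sqrt (- t0) = - t0) by (apply sqrt_sqrt; lra).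
  unfold first_iterate, first_drop_rate; simpl; unfold tm; simpl.
  set (s := sqrt (- t0)) in *.
  replace t0 with (- (s * s)) by lra.
  field; auto.
Qed.

Lemma xsol_1_deficit_scaled (t0 alpha h q : R) :
  t0 <= 0 -> h <> 0 -> q <> 0 ->
  - tm t0 h 1 - xsol t0 alpha (q * h ^ 2) h 1 ^ 2 =
  h * first_deficit_rate (sqrt (- t0)) alpha h q.
Proof.
  intros ht0 hh hq.
  rewrite xsol_1_scaled by assumption.
  assert (hs : sqrt (- t0) * sqrt (- t0) = - t0) by (apply sqrt_sqrt; lra).
  unfold first_iterate, first_deficit_rate, tm; simpl; ring [hs].
Qed.

Lemma xsol_2_scaled (t0 alpha h q : R) :
  t0 <= 0 -> h <> 0 -> q <> 0 ->
  q * xsol t0 alpha (q * h ^ 2) h 2 =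
  q * first_iterate (sqrt (- t0)) alpha h q +
    first_deficit_rate (sqrt (- t0)) alpha h q.
Proof.
  intros ht0 hh hq.
  assert (hdef := xsol_1_deficit_scaled t0 alpha h q ht0 hh hq).
  rewrite <- xsol_1_scaled by assumption.
  set (x := xsol t0 alpha (q * h ^ 2) h) in *.
  change (x 2%nat) with
    (- (h / (q * h ^ 2)) * x 1%nat ^ 2 + x 1%nat - h / (q * h ^ 2) * tm t0 h 1).
  apply Rmult_eq_reg_l with h; [| exact hh].
  rewrite Rmult_plus_distr_l, <- hdef.
  field; auto.
Qed.

Local Ltac continuity_2d :=
  simpl; repeat first
    [ apply continuity_2d_pt_const | apply continuity_2d_pt_id1
    | apply continuity_2d_pt_id2 | apply continuity_2d_pt_minus
    | apply continuity_2d_pt_plus | apply continuity_2d_pt_mult ].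

Lemma locally_2d_first_iterate_pos (s alpha : R) :
  0 < s -> locally_2d (fun h q => 0 < first_iterate s alpha h q) 0 0.
Proof.
  intros hs; apply continuity_2d_pt_pos; unfold first_iterate, first_drop_rate.
  - continuity_2d.
  - lra.
Qed.

Lemma locally_2d_first_deficit_pos (s alpha : R) :
  1 < 4 * s ^ 2 * alpha ->
  locally_2d (fun h q => 0 < first_deficit_rate s alpha h q) 0 0.
Proof.
  intros ha; apply continuity_2d_pt_pos;
    unfold first_deficit_rate, first_drop_rate.
  - continuity_2d.
  - lra.
Qed.

Lemma locally_2d_second_excess_pos (s alpha : R) :
  1 < 4 * s ^ 2 * alpha ->
  locally_2d (fun h q =>
    0 < q * (first_iterate s alpha h q - s - q * h) +
          first_deficit_rate s alpha h q) 0 0.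
Proof.
  intros ha; apply continuity_2d_pt_pos;
    unfold first_iterate, first_deficit_rate, first_drop_rate.
  - continuity_2d.
  - lra.
Qed.

Lemma tips_at_third_step_scaled (t0 alpha h q : R) :
  let s := sqrt (- t0) in
  t0 <= 0 -> 0 < h -> 0 < q -> tm t0 h 3 <= 0 ->
  0 < first_iterate s alpha h q ->
  0 < first_deficit_rate s alpha h q ->
  0 < q * (first_iterate s alpha h q - s - q * h) +
        first_deficit_rate s alpha h q ->
  tips_at_third_step t0 alpha (q * h ^ 2) h.
Proof.
  intros s ht0 hh hq ht3 hx1 hdeficit hexcess.
  assert (h_neq0 : h <> 0) by lra.
  assert (q_neq0 : q <> 0) by lra.
  assert (x1_eq := xsol_1_scaled t0 alpha h q ht0 h_neq0 q_neq0).
  assert (deficit_eq := xsol_1_deficit_scaled t0 alpha h q ht0 h_neq0 q_neq0).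
  assert (x2_eq := xsol_2_scaled t0 alpha h q ht0 h_neq0 q_neq0).
  fold s in x1_eq, deficit_eq, x2_eq.
  apply tips_at_third_step_of_excess; try assumption; fold s.
  - now apply Rmult_lt_0_compat, pow_lt.
  - now rewrite x1_eq.
  - apply Rlt_0_minus; rewrite deficit_eq; now apply Rmult_lt_0_compat.
  - assert (q * h < xsol t0 alpha (q * h ^ 2) h 2 - s)
      by (apply Rmult_lt_reg_l with q; lra).
    apply Rle_lt_trans with (h * (q * h)); [right; ring |].
    now apply Rmult_lt_compat_l.
Qed.

Lemma locally_2d_tips_at_third_step (t0 alpha : R) :
  t0 < 0 -> 1 < alpha * (- 4 * t0) ->
  locally_2d (fun h q => 0 < h -> 0 < q ->
    tips_at_third_step t0 alpha (q * h ^ 2) h) 0 0.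
Proof.
  intros ht0 ha.
  assert (hs : 0 < sqrt (- t0)) by (apply sqrt_lt_R0; lra).
  assert (hgap : 1 < 4 * sqrt (- t0) ^ 2 * alpha)
    by (rewrite pow2_sqrt by lra; lra).
  assert (t3_neg : locally_2d (fun h q => 0 < - t0 - 3 * h) 0 0)
    by (apply continuity_2d_pt_pos; [continuity_2d | lra]).
  generalize
    (locally_2d_and _ _ _ _
      (locally_2d_and _ _ _ _ t3_neg
        (locally_2d_first_iterate_pos _ alpha hs))
      (locally_2d_and _ _ _ _ (locally_2d_first_deficit_pos _ _ hgap)
        (locally_2d_second_excess_pos _ _ hgap))).
  apply locally_2d_impl, locally_2d_forall.
  intros h q [[ht3 hx1] [hdeficit hexcess]] hh hq.
  apply tips_at_third_step_scaled; try assumption; [lra |].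
  unfold tm; simpl; lra.
Qed.

Lemma at_right_tips_at_third_step (t0 alpha C b : R) :
  t0 < 0 -> 1 < alpha * (- 4 * t0) -> 0 < C -> 0 < b < 1 / 2 ->
  at_right 0 (fun eps => tips_at_third_step t0 alpha eps (C * Rpower eps b)).
Proof.
  intros ht0 ha hC hb.
  assert (dt_lim := filterlim_scal_Rpower_at_right_0 C b (proj1 hb)).
  assert (ratio_lim :=
    filterlim_scal_Rpower_at_right_0 (/ C ^ 2) (1 - 2 * b) ltac:(lra)).
  assert (near := filterlim_locally_2d _ _ _ _ _ _ dt_lim ratio_lim
    (locally_2d_tips_at_third_step t0 alpha ht0 ha)).
  apply (filter_imp (F := locally 0)) with (2 := near); intros eps htips he.
  rewrite <- (Rpower_mul_sqr_scal C b eps) at 1 by lra.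
  apply (htips he); apply Rmult_lt_0_compat; try apply exp_pos; [exact hC |].
  apply Rinv_0_lt_compat, pow_lt; lra.
Qed.

Theorem theorem2 (t0 alpha : R) (ht0 : t0 < 0) (halpha : 0 < alpha) :
  (forall eps dt : R, 0 < eps < 1 -> dt > 1 / alpha ->
     xsol t0 alpha eps dt 1 < - sqrt (Rmax (- tm t0 dt 1) 0) /\
     tipping_point_at t0 alpha eps dt 1)
  /\
  (forall C b : R, 0 < C -> 0 < b < 1 / 2 -> alpha > 1 / (- 4 * t0) ->
     exists eps0 : R, 0 < eps0 < 1 /\
       forall eps : R, 0 < eps < eps0 ->
         let dt := C * Rpower eps b in
         (forall m : nat, m = 1%nat \/ m = 2%nat ->
            xsol t0 alpha eps dt m > 0 /\
            (-1) ^ m * (xsol t0 alpha eps dt m - sqrt (- tm t0 dt m)) > 0) /\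
         (tm t0 dt 3 <= 0 /\
          xsol t0 alpha eps dt 3 < - sqrt (- tm t0 dt 3)) /\
         tipping_point_at t0 alpha eps dt 3).
Proof.
  split.
  - intros eps dt [he _] hdt; rewrite sqrt_Rmax_0.
    assert (hx1 := xsol_1_lt t0 alpha eps dt (Rlt_le _ _ ht0) halpha he hdt).
    split; [exact hx1 |].
    apply tipping_point_at_of_first; [lia | exact hx1 | lia].
  - intros C b hC hb ha.
    apply at_right_exists_lt; [lra |].
    apply at_right_tips_at_third_step; try assumption.
    apply Rlt_div_l; lra.
Qed.
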